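(* Let $\Omega\subseteq\mathbb{R}^n$ be a nonempty, open, bounded set and let $D$ be a linear differential operator with smooth real-valued coefficients on $\Omega$. Then there exists a constant $c>0$, depending only on $n$, $\Omega$ and $D$, such that every smooth function $u:\Omega\to\mathbb{R}$ satisfying $Du\geq 1$ on $\Omega$ satisfies $\|u\|_{L^1(\Omega)}\geq c$.
   Context: A linear differential operator with smooth coefficients is a finite sum $D=\sum_{\alpha}a_\alpha(x)\partial^\alpha$ with each $a_\alpha\in C^\infty(\Omega)$. $\|u\|_{L^1(\Omega)}$ may equal $+\infty$. *)

(* Defs.v *)
From HB Require Import structures.
From mathcomp Require Import all_boot all_order all_algebra.
From mathcomp Require Import finmap.
From mathcomp Require Import all_classical all_reals all_analysis.

Set Implicit Arguments.
Unset Strict Implicit.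
Unset Printing Implicit Defensive.

Import Order.TTheory GRing.Theory Num.Theory.
Import numFieldNormedType.Exports.

Local Open Scope classical_set_scope.
Local Open Scope ring_scope.

(* R^n is ['rV[R]_n].  The library gives it its usual topology and norm; we add
   the product (= Borel) sigma-algebra and Lebesgue measure. *)

Fact rV_display : measure_display.
Proof. exact: default_measure_display. Qed.

Section measurable_rV.
Context (R : realType) (n : nat).

Definition rV_coord (i : 'I_n) (x : 'rV[R]_n) : R := x ord0 i.

Let rV_set0 : g_sigma_preimage rV_coord set0.
Proof. exact: sigma_algebra0. Qed.

Let rV_setC A : g_sigma_preimage rV_coord A -> g_sigma_preimage rV_coord (~` A).
Proof. exact: sigma_algebraC. Qed.

Let rV_bigcup (F : _^nat) : (forall i, g_sigma_preimage rV_coord (F i)) ->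
  g_sigma_preimage rV_coord (\bigcup_i (F i)).
Proof. exact: sigma_algebra_bigcup. Qed.

HB.instance Definition _ := @isMeasurable.Build rV_display
  'rV[R]_n (g_sigma_preimage rV_coord) rV_set0 rV_setC rV_bigcup.

Lemma measurable_rV_coord (i : 'I_n) : measurable_fun [set: 'rV[R]_n] (rV_coord i).
Proof.
move=> _ Y mY; rewrite setTI; apply: sub_sigma_algebra => /=.
rewrite -bigcup_seq/=; exists i => /=; first by rewrite mem_index_enum.
by exists Y => //; rewrite setTI.
Qed.

Lemma measurable_fun_rV d (T : measurableType d) (f : T -> 'rV[R]_n) :
  (forall i, measurable_fun [set: T] (rV_coord i \o f)) ->
  measurable_fun [set: T] f.
Proof.
move=> mf; apply: (@measurability _ _ _ _ setT f
  (\big[setU/set0]_(i < n) preimage_set_system setT (rV_coord i) measurable)) => //.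
move=> _ [B + <-]; rewrite -bigcup_seq/= => -[i _ [C mC <-]].
by rewrite setTI setTI -comp_preimage -[X in measurable X]setTI; exact: mf.
Qed.

End measurable_rV.

Section lebesgue_rV.
Context (R : realType).

Definition rV_cons n (p : R * 'rV[R]_n) : 'rV[R]_n.+1 :=
  \row_i if unlift ord0 i is Some j then p.2 ord0 j else p.1.

Definition rV_uncons n (x : 'rV[R]_n.+1) : R * 'rV[R]_n :=
  (x ord0 ord0, \row_j x ord0 (lift ord0 j)).

Lemma rV_consK n : cancel (@rV_cons n) (@rV_uncons n).
Proof.
move=> [a x]; rewrite /rV_uncons /rV_cons mxE unlift_none; congr pair.
by apply/rowP => j; rewrite !mxE liftK.
Qed.

Lemma rV_unconsK n : cancel (@rV_uncons n) (@rV_cons n).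
Proof.
move=> x; apply/rowP => i; rewrite mxE.
by case: unliftP => [j ->|->]; rewrite ?mxE.
Qed.

Lemma measurable_rV_cons n : measurable_fun setT (@rV_cons n).
Proof.
apply: measurable_fun_rV => i; case: (unliftP ord0 i) => [j|] ->.
  rewrite (_ : _ \o _ = rV_coord j \o snd).
    exact: measurableT_comp (measurable_rV_coord j) measurable_snd.
  by apply/funext => p /=; rewrite /rV_coord mxE liftK.
rewrite (_ : _ \o _ = fst); first exact: measurable_fst.
by apply/funext => p /=; rewrite /rV_coord mxE unlift_none.
Qed.

Lemma measurable_rV_uncons n : measurable_fun setT (@rV_uncons n).
Proof.
apply: measurable_fun_pair; first exact: (measurable_rV_coord ord0).
apply: measurable_fun_rV => j.
rewrite (_ : _ \o _ = rV_coord (lift ord0 j)); first exact: measurable_rV_coord.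
by apply/funext => x; rewrite /rV_coord /= mxE.
Qed.

Section step.
Context n (mu : {sigma_finite_measure set 'rV[R]_n -> \bar R}).

Definition lebesgue_rV_succ : set 'rV[R]_n.+1 -> \bar R :=
  pushforward (@lebesgue_measure R \x mu)%E (@rV_cons n).

Let measurable_preimage (A : set 'rV[R]_n.+1) :
  measurable A -> measurable (@rV_cons n @^-1` A).
Proof.
by move=> mA; rewrite -[X in measurable X]setTI; exact: measurable_rV_cons.
Qed.

Let succ0 : lebesgue_rV_succ set0 = 0%E.
Proof. by rewrite /lebesgue_rV_succ /pushforward preimage_set0 measure0. Qed.

Let succ_ge0 A : (0 <= lebesgue_rV_succ A)%E.
Proof. by rewrite /lebesgue_rV_succ /pushforward; exact: measure_ge0. Qed.

Let succ_sigma_additive : semi_sigma_additive lebesgue_rV_succ.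
Proof.
move=> F mF tF mUF; rewrite /lebesgue_rV_succ /pushforward preimage_bigcup.
apply: measure_semi_sigma_additive.
- by move=> k; exact: measurable_preimage.
- apply/trivIsetP => /= i j _ _ ij; rewrite -preimage_setI.
  by move/trivIsetP : tF => /(_ _ _ _ _ ij) ->//; rewrite preimage_set0.
- by rewrite -preimage_bigcup; exact: measurable_preimage.
Qed.

HB.instance Definition _ := isMeasure.Build _ _ _ lebesgue_rV_succ
  succ0 succ_ge0 succ_sigma_additive.

Let succ_sigma_finite : sigma_finite setT lebesgue_rV_succ.
Proof.
have /sigma_finiteP[F [TF ndF Foo]] := sigma_finiteT (@lebesgue_measure R).
have /sigma_finiteP[G [TG ndG Goo]] := sigma_finiteT mu.
exists (fun k => @rV_uncons n @^-1` (F k `*` G k)).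
  rewrite -preimage_bigcup (_ : \bigcup_k _ = setT) ?preimage_setT//.
  rewrite -setXTT TF TG predeqE => -[x y]; split.
    by move=> [k _ []/= ? ?]; split; exists k.
  move=> [/= [k _ Fkx] [l _ Gly]]; exists (maxn k l) => //; split.
  - by move: x Fkx; exact/subsetPset/ndF/leq_maxl.
  - by move: y Gly; exact/subsetPset/ndG/leq_maxr.
move=> k; have [mF Fk] := Foo k; have [mG Gk] := Goo k; split.
  rewrite -[X in measurable X]setTI; apply: measurable_rV_uncons => //.
  exact: measurableX.
rewrite /lebesgue_rV_succ /pushforward (_ : _ @^-1` _ = F k `*` G k).
  by rewrite product_measure1E// lte_mul_pinfty// ge0_fin_numE.
by rewrite -comp_preimage (_ : _ \o _ = id)//; apply/funext; exact: rV_consK.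
Qed.

HB.instance Definition _ := Measure_isSigmaFinite.Build _ _ _ lebesgue_rV_succ
  succ_sigma_finite.

End step.

(* Lebesgue measure on R^n: R^0 is a point of mass 1, and Lebesgue measure on
   R^(n+1) is the product of those on R and on R^n. *)
Fixpoint lebesgue_rV n : {sigma_finite_measure set 'rV[R]_n -> \bar R} :=
  if n is m.+1 then lebesgue_rV_succ (lebesgue_rV m) else \d_(0 : 'rV[R]_0).

Lemma lebesgue_rV_box n (A : 'I_n -> set R) :
  (forall i, measurable (A i)) ->
  lebesgue_rV n [set x | forall i, A i (x ord0 i)] =
  (\prod_(i < n) @lebesgue_measure R (A i))%E.
Proof.
elim: n A => [|n IHn] A mA /=.
  by rewrite big_ord0 diracE mem_set//= => -[].
pose B := [set x : 'rV[R]_n | forall i, A (lift ord0 i) (x ord0 i)].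
have mB : measurable B.
  rewrite (_ : B = \bigcap_(i in [set: 'I_n])
    (rV_coord i @^-1` (A (lift ord0 i)))).
    apply: fin_bigcap_measurable => // i _.
    by rewrite -[X in measurable X]setTI; exact: measurable_rV_coord.
  by apply/seteqP; split=> x /= Ax i => [_|]; exact: Ax.
rewrite big_ord_recl -(IHn (fun i => A (lift ord0 i))); last by move=> i; exact: mA.
rewrite -product_measure1E//; last exact: mA.
rewrite /lebesgue_rV_succ /pushforward; congr product_measure1.
apply/seteqP; split=> -[a x] /= Ax.
- split=> [|j] /=; first by have := Ax ord0; rewrite mxE unlift_none.
  by have := Ax (lift ord0 j); rewrite mxE liftK.
- move=> i; rewrite mxE.
  by case: unliftP => [j|] -> /=; [exact: Ax.2|exact: Ax.1].
Qed.

End lebesgue_rV.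

Section differential_operators.
Context (R : realType) (n : nat).
Implicit Types (f u : 'rV[R]_n -> R) (Omega : set 'rV[R]_n).

Definition partial (i : 'I_n) f : 'rV[R]_n -> R := 'D_(delta_mx ord0 i) f.

Definition partials (s : seq 'I_n) f : 'rV[R]_n -> R := foldr partial f s.

Definition multi_index := {ffun 'I_n -> nat}.

Definition mpartial (alpha : multi_index) : ('rV[R]_n -> R) -> 'rV[R]_n -> R :=
  partials (flatten [seq nseq (alpha i) i | i <- enum 'I_n]).

(* A function on Omega is represented by any extension of it to R^n: for Omega
   open, smoothness on Omega and the derivatives at points of Omega do not
   depend on the extension. *)
Definition smooth_on Omega f := forall (s : seq 'I_n) (x : 'rV[R]_n), Omega x ->
  {for x, continuous (partials s f)} /\
  forall i, derivable (partials s f) x (delta_mx ord0 i).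

Record diff_operator Omega := DiffOperator {
  do_support : {fset multi_index};
  do_coef : multi_index -> 'rV[R]_n -> R;
  do_smooth : forall alpha, alpha \in do_support -> smooth_on Omega (do_coef alpha)
}.

Definition do_apply Omega (D : diff_operator Omega) u (x : 'rV[R]_n) : R :=
  \sum_(alpha <- do_support D) do_coef D alpha x * mpartial alpha u x.

Definition L1norm Omega u : \bar R :=
  (\int[lebesgue_rV R n]_(x in Omega) `|u x|%:E)%E.

End differential_operators.

(* Main.v *)
(* Let Q be a closed box in Omega and P(x) = \prod_i (x_i - a_i) (b_i - x_i), which
   is nonnegative on Q and vanishes on its boundary.  For k at least the order of
   D, integrating by parts in the box gives \int_Q P^k D u = \int_Q h u, where h is
   smooth on Omega and depends only on D and Q: no boundary term appears, and P^k
   thus replaces a compactly supported test function.  If D u >= 1 then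
   \int_Q P^k <= \int_Q P^k D u <= sup_Q |h| * \int_Q |u|. *)

Require Import Defs.
From mathcomp Require Import all_boot all_order all_algebra.
From mathcomp Require Import finmap.
From mathcomp Require Import all_classical all_reals all_analysis.
From mathcomp Require Import measurable_realfun ring lra.
Import Order.TTheory GRing.Theory Num.Theory.
Import numFieldNormedType.Exports.

Local Open Scope classical_set_scope.
Local Open Scope ring_scope.

Set Implicit Arguments.
Unset Strict Implicit.

(** * Measurability and integrability on closed boxes of R^n *)

Section integration_over_boxes.
Context (R : realType).

Lemma measurable_rV_rect n (A : 'I_n -> set R) : (forall i, measurable (A i)) ->
  measurable [set x : 'rV[R]_n | forall i, A i (x ord0 i)].
Proof.
move=> mA.
rewrite (_ : [set _ | _] = \bigcap_(i in [set: 'I_n]) (@rV_coord R n i @^-1` A i)).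
  apply: fin_bigcap_measurable => // i _.
  by rewrite -[X in measurable X]setTI; exact: measurable_rV_coord.
by apply/seteqP; split=> x /= Ax i => [_|]; exact: Ax.
Qed.

(** The sigma-algebra is generated by the coordinates, so [U] is exhibited as the countable union of
    the rational open boxes it contains. They cover [U] because balls of R^n are cubes. *)
Lemma open_measurable_rV n (U : set 'rV[R]_n) : open U -> measurable U.
Proof.
move=> oU.
pose B (p : {ffun 'I_n -> rat * rat}) : set 'rV[R]_n :=
  [set x | forall i, `]ratr (p i).1, ratr (p i).2[%classic (x ord0 i)].
rewrite (_ : U = \bigcup_p (if `[< B p `<=` U >] then B p else set0)).
  apply: (countable_bigcupT_measurable (T := 'rV[R]_n)) => [|p]; first exact: countableP.
  case: asboolP => // _.
  apply: (@measurable_rV_rect n (fun i => `]ratr (p i).1, ratr (p i).2[%classic)) => i.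
  exact: measurable_itv.
apply/seteqP; split => [x Ux|x [p _]]; last by case: asboolP => // + /= => /[apply].
have /nbhs_ballP[e /= e0 xeU] : nbhs x U by exact: open_nbhs_nbhs.
have /choice[q qP] i : exists q : rat * rat, x ord0 i - e < ratr q.1 < x ord0 i /\
    x ord0 i < ratr q.2 < x ord0 i + e.
  have /rat_in_itvoo[q1] : x ord0 i - e < x ord0 i by rewrite ltrBlDr ltrDl.
  have /rat_in_itvoo[q2] : x ord0 i < x ord0 i + e by rewrite ltrDl.
  by rewrite !in_itv /= => q2P q1P; exists (q1, q2).
exists [ffun i => q i] => //; case: asboolP => [_ i|[]] /=.
  by rewrite ffunE in_itv /=; have [/andP[_ ->] /andP[->]] := qP i.
move=> y By; apply: xeU; split=> // i j; rewrite (ord1 i).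
have := By j; rewrite /= ffunE in_itv /= => /andP[qy yq].
have [/andP[xq _] /andP[_ qx]] := qP j.
by rewrite /ball /= ltr_distlC (lt_trans xq qy) (lt_trans yq qx).
Qed.

Definition box n (a b : 'I_n -> R) : set 'rV[R]_n :=
  [set x | forall i, `[a i, b i]%classic (x ord0 i)].

Lemma measurable_box n (a b : 'I_n -> R) : measurable (box a b).
Proof.
apply: (@measurable_rV_rect n (fun i => `[a i, b i]%classic)) => i.
exact: measurable_itv.
Qed.

Lemma lebesgue_box n (a b : 'I_n -> R) : (forall i, a i <= b i) ->
  lebesgue_rV R n (box a b) = (\prod_(i < n) (b i - a i))%:E.
Proof.
move=> ab; rewrite (lebesgue_rV_box (A := fun i => `[a i, b i]%classic)); last first.
  by move=> i; exact: measurable_itv.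
rewrite -prodEFin; apply: eq_bigr => i _.
rewrite lebesgue_measure_itv /= lte_fin EFinB; case: ltP => // ba.
by rewrite (_ : a i = b i) ?subee//; apply/eqP; rewrite eq_le ab.
Qed.

(** Continuity holds in the whole space at the points of [A], so a point of [A] sent into an open
    [V] is interior to the preimage of [V]. *)
Lemma measurable_fun_rV_continuous n (A : set 'rV[R]_n) (f : 'rV[R]_n -> R) :
  measurable A -> (forall x, A x -> {for x, continuous f}) -> measurable_fun A f.
Proof.
move=> mA cf.
apply: (measurability _ (RGenOpens.measurableE R)) => _ [_ [y [z ->]] <-].
set V := (X in _ @^-1` X); have oV : open V by exact: interval_open.
rewrite (_ : A `&` _ = A `&` interior (f @^-1` V)).
  by apply: measurableI => //; apply: open_measurable_rV; exact: open_interior.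
apply/seteqP; split=> x [Ax fx]; split=> //; last exact: (interior_subset fx).
by apply: cf => //; exact: open_nbhs_nbhs.
Qed.

Lemma compact_box n (a b : 'I_n -> R) : compact (box a b).
Proof.
apply: (@rV_compact R n (fun i => `[a i, b i]%classic)) => i.
exact: segment_compact.
Qed.

Lemma box_bounded n (a b : 'I_n -> R) (f : 'rV[R]_n -> R) :
  (forall x, box a b x -> {for x, continuous f}) ->
  exists2 K, 0 < K & forall x, box a b x -> `|f x| <= K.
Proof.
move=> cf.
have /compact_bounded[M [_ MP]] : compact (f @` box a b).
  apply: continuous_compact; last exact: compact_box.
  by apply: continuous_in_subspaceT => x /set_mem; exact: cf.
(* Adding 1 makes the bound both positive and strictly larger than [M]. *)
exists (`|M| + 1); first by rewrite ltr_pwDr.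
by move=> x Qx; apply: MP; [rewrite ltr_pwDr// ler_norm|exists x].
Qed.

(** A continuous function is bounded on a compact box, and the box has finite measure. *)
Lemma integrable_box n (a b : 'I_n -> R) (f : 'rV[R]_n -> R) :
  (forall i, a i <= b i) ->
  (forall x, box a b x -> {for x, continuous f}) ->
  (lebesgue_rV R n).-integrable (box a b) (EFin \o f).
Proof.
move=> ab cf; have mQ := measurable_box a b.
apply: measurable_bounded_integrable => //.
- by rewrite [X in (X < _)%E]lebesgue_box// ltry.
- exact: measurable_fun_rV_continuous.
have [K K0 KP] := box_bounded cf.
exists K; split; first exact: gtr0_real.
by move=> M KM x Qx; apply: (le_trans (KP x Qx)); exact: ltW.
Qed.
End integration_over_boxes.

(** * Calculus of smooth functions on an open set *)

Section smooth.
Context (R : realType) (n : nat) (Omega : set 'rV[R]_n).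
Hypothesis Omega_open : open Omega.
Implicit Types f g : 'rV[R]_n -> R.

(* Recursing through [partial i f], rather than over [partials s f] as [smooth_on]
   does, lets the product rule go through by induction on [k]. *)
Fixpoint Ck (k : nat) f : Prop :=
  (forall x, Omega x -> {for x, continuous f}) /\
  if k is k'.+1 then
    forall i, (forall x, Omega x -> derivable f x (delta_mx ord0 i)) /\
      Ck k' (partial i f)
  else True.

(** [partials (rcons s i) f] is [partials s (partial i f)], so removing the last index of [s]
    matches one unfolding of [Ck]. *)
Lemma smooth_onP f : smooth_on Omega f <-> forall k, Ck k f.
Proof.
split=> [sf k|Cf s].
  elim: k f sf => [|k IHk] f sf; split=> //; try by move=> x Ox; case: (sf [::] x Ox).
  move=> i; split=> [x Ox|]; first by case: (sf [::] x Ox).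
  by apply: IHk => s x Ox; have := sf (rcons s i) x Ox; rewrite /partials foldr_rcons.
elim/last_ind: s f Cf => [|s i IHs] f Cf x Ox.
  by split=> [|i]; have [cf df] := Cf 1%N; [exact: cf|exact: (df i).1].
rewrite /partials foldr_rcons; apply: IHs => // k.
by have [_ /(_ i)[]] := Cf k.+1.
Qed.

Let nearO (P : 'rV[R]_n -> Prop) x : (forall y, Omega y -> P y) -> Omega x ->
  \near x, P x.
Proof.
move=> PO Ox; have : nbhs x Omega by exact: open_nbhs_nbhs.
by apply: filterS.
Qed.

Let partial_ext i f g : (forall x, Omega x -> f x = g x) ->
  forall x, Omega x -> partial i f x = partial i g x.
Proof. by move=> fg x Ox; apply: near_eq_derive; exact: nearO. Qed.

(** Derivatives at a point of the open set [Omega] see only nearby values. The sum and product rules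
    identify partial derivatives on [Omega] only, so [CkD] and [CkM] go through this lemma. *)
Let Ck_ext k f g : (forall x, Omega x -> f x = g x) -> Ck k f -> Ck k g.
Proof.
elim: k f g => [|k IHk] f g fg [cf df].
  split=> // x Ox; rewrite /prop_for /continuous_at -fg//.
  exact: (cvg_trans (near_eq_cvg (nearO fg Ox)) (cf x Ox)).
split.
  move=> x Ox; rewrite /prop_for /continuous_at -fg//.
  exact: (cvg_trans (near_eq_cvg (nearO fg Ox)) (cf x Ox)).
move=> i; have [dfi Cfi] := df i; split.
  by move=> x Ox; apply: near_eq_derivable (dfi x Ox); exact: nearO Ox.
by apply: IHk Cfi; exact: partial_ext.
Qed.

Let CkW k f : Ck k.+1 f -> Ck k f.
Proof.
elim: k f => [|k IHk] f [cf df]; split => // i.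
by have [dfi Cfi] := df i; split=> //; exact: IHk.
Qed.

Let Ck_cst k c : Ck k (cst c).
Proof.
elim: k c => [|k IHk] c; split=> //; try by move=> x _; exact: cst_continuous.
move=> i; split=> [x _|]; first exact: derivable_cst.
rewrite (_ : partial i _ = cst 0)//.
by apply/funext => x; rewrite /partial derive_cst.
Qed.

Let CkD k f g : Ck k f -> Ck k g -> Ck k (f + g).
Proof.
elim: k f g => [|k IHk] f g [cf df] [cg dg]; split=> //;
  try by move=> x Ox; apply: continuousD; [exact: cf|exact: cg].
move=> i; have [dfi Cfi] := df i; have [dgi Cgi] := dg i.
split=> [x Ox|]; first by apply: derivableD; [exact: dfi|exact: dgi].
apply: Ck_ext (IHk _ _ Cfi Cgi) => x Ox; rewrite /partial deriveD//.
  exact: dfi.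
exact: dgi.
Qed.

(** In the product rule each term keeps one factor undifferentiated; [CkW] lowers that factor to the
    order of the differentiated one. *)
Let CkM k f g : Ck k f -> Ck k g -> Ck k (f * g).
Proof.
elim: k f g => [|k IHk] f g Cf Cg; case: (Cf) (Cg) => [cf df] [cg dg]; split=> //;
  try by move=> x Ox; apply: continuousM; [exact: cf|exact: cg].
move=> i; have [dfi Cfi] := df i; have [dgi Cgi] := dg i.
split=> [x Ox|]; first by apply: derivableM; [exact: dfi|exact: dgi].
apply: Ck_ext (CkD (IHk _ _ (CkW Cf) Cgi) (IHk _ _ (CkW Cg) Cfi)) => x Ox.
by rewrite /partial deriveM//; [exact: dfi|exact: dgi].
Qed.

Lemma smooth_on_ext f g : (forall x, Omega x -> f x = g x) ->
  smooth_on Omega f -> smooth_on Omega g.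
Proof. by move=> fg /smooth_onP Cf; apply/smooth_onP => k; exact: Ck_ext (Cf k). Qed.

Lemma smooth_on_cst c : smooth_on Omega (cst c).
Proof. by apply/smooth_onP => k; exact: Ck_cst. Qed.

Lemma smooth_onD f g : smooth_on Omega f -> smooth_on Omega g -> smooth_on Omega (f + g).
Proof. by move=> /smooth_onP Cf /smooth_onP Cg; apply/smooth_onP => k; exact: CkD. Qed.

Lemma smooth_onM f g : smooth_on Omega f -> smooth_on Omega g -> smooth_on Omega (f * g).
Proof. by move=> /smooth_onP Cf /smooth_onP Cg; apply/smooth_onP => k; exact: CkM. Qed.

Lemma smooth_onX f k : smooth_on Omega f -> smooth_on Omega (f ^+ k).
Proof.
move=> sf; elim: k => [|k IHk]; first exact: smooth_on_cst.
by rewrite exprS; exact: smooth_onM.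
Qed.

Lemma smooth_on_continuous f x : smooth_on Omega f -> Omega x ->
  {for x, continuous f}.
Proof. by move=> sf Ox; exact: (sf [::] x Ox).1. Qed.

Lemma smooth_on_derivable f x i : smooth_on Omega f -> Omega x ->
  derivable f x (delta_mx ord0 i).
Proof. by move=> sf Ox; exact: (sf [::] x Ox).2. Qed.

Lemma partialM f g x i : smooth_on Omega f -> smooth_on Omega g -> Omega x ->
  partial i (f * g) x = f x * partial i g x + partial i f x * g x.
Proof.
move=> sf sg Ox; rewrite [partial i f x * _]mulrC /partial.
by rewrite (deriveM (smooth_on_derivable sf Ox) (smooth_on_derivable sg Ox)).
Qed.

Lemma partialX f k x i : smooth_on Omega f -> Omega x ->
  partial i (f ^+ k) x = k%:R * f x ^+ k.-1 * partial i f x.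
Proof. by move=> sf Ox; rewrite /partial (deriveX k (smooth_on_derivable sf Ox)). Qed.

Lemma smooth_on_prod (I : Type) (s : seq I) (F : I -> 'rV[R]_n -> R) :
  (forall i, smooth_on Omega (F i)) ->
  smooth_on Omega (fun x => \prod_(i <- s) F i x).
Proof.
move=> sF; elim: s => [|i s IHs].
  by under eq_fun do rewrite big_nil; exact: smooth_on_cst.
by under eq_fun do rewrite big_cons; exact: smooth_onM (sF i) IHs.
Qed.

Lemma smooth_on_partials s f : smooth_on Omega f -> smooth_on Omega (partials s f).
Proof. by move=> sf t x Ox; have := sf (t ++ s) x Ox; rewrite /partials foldr_cat. Qed.

Lemma smooth_on_coord i : smooth_on Omega (fun x => x ord0 i).
Proof.
have D x v : is_derive x v (fun x : 'rV[R]_n => x ord0 i : R) (v ord0 i).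
  have C : h^-1 *: ((h *: v + x) ord0 i - x ord0 i) @[h --> (0:R)^'] --> v ord0 i.
    (* For nonzero [h] the difference quotient is exactly [v ord0 i]. *)
    apply: cvg_near_cst; near=> h.
    rewrite !mxE addrK scalerA mulVf ?scale1r//; near: h; exact: nbhs_dnbhs_neq.
  by split; [apply/cvg_ex; exists (v ord0 i)|exact: cvg_lim].
apply/smooth_onP => -[|k]; split=> //; try by move=> x _; exact: coord_continuous.
move=> j; split=> [x _|]; first exact: ex_derive.
rewrite (_ : partial j _ = cst (delta_mx (ord0 : 'I_1) j ord0 i))//.
by apply/funext => x; rewrite /partial derive_val.
Unshelve. all: by end_near. Qed.

End smooth.

(** * Vanishing of the integral of a partial derivative over a box *)

Section divergence_over_boxes.
Context (R : realType).

(** Both difference quotients are the same function of [h]. The conclusions are paired equalities,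
    so that one instance rewrites derivability as well as the derivative. *)
Lemma derive_comp_affine (V W : normedModType R) (F : W -> R) (phi : V -> W) x v w :
  (forall h, phi (h *: v + x) = h *: w + phi x) ->
  (derivable (F \o phi) x v = derivable F (phi x) w) *
  ('D_v (F \o phi) x = 'D_w F (phi x)).
Proof.
move=> phiE; rewrite /derivable /derive.
suff -> : (fun h : R => h^-1 *: ((F \o phi) (h *: v + x) - (F \o phi) x)) =
  (fun h : R => h^-1 *: (F (h *: w + phi x) - F (phi x))) by [].
by apply/funext => h /=; rewrite phiE.
Qed.

(** This lemma and the next supply the hypothesis of [derive_comp_affine] for slices along the first
    coordinate and along the others. *)
Lemma rV_cons_deltal n (p : R * 'rV[R]_n) h :
  rV_cons (h *: 1 + p.1, p.2) = h *: delta_mx ord0 ord0 + rV_cons p.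
Proof.
apply/rowP => i; rewrite !mxE eqxx /=.
by case: unliftP => [j ->|->]; rewrite ?unlift_none ?liftK//= mulr0 add0r.
Qed.

Lemma rV_cons_deltar n (p : R * 'rV[R]_n) (j : 'I_n) h :
  rV_cons (p.1, h *: delta_mx ord0 j + p.2) =
  h *: delta_mx ord0 (lift ord0 j) + rV_cons p.
Proof.
apply/rowP => i; rewrite !mxE eqxx /=.
case: unliftP => [k ->|->]; rewrite ?mxE ?eqxx/= ?(inj_eq lift_inj)//.
by rewrite mulr0 add0r.
Qed.

Lemma continuous_rV_cons n : continuous (@rV_cons R n).
Proof.
move=> p; apply/cvg_ballP => e e0; have := nbhsx_ballx p e e0.
apply: filterS => q [pq1 [_ pq2]].
split => // i j; rewrite !mxE.
by case: unliftP => [k _|_]; [exact: pq2|exact: pq1].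
Qed.

Lemma box_cons n (a b : 'I_n.+1 -> R) t y : box a b (rV_cons (t, y)) =
  (`[a ord0, b ord0]%classic t /\
   box (a \o lift ord0) (b \o lift ord0) y).
Proof.
apply/propext; split=> [Q|[Qt Qy] i].
  split=> [|j]; first by have := Q ord0; rewrite mxE unlift_none.
  by have := Q (lift ord0 j); rewrite mxE liftK.
by rewrite mxE; case: unliftP => [j|] ->; [exact: Qy|exact: Qt].
Qed.

(** * Fubini on a box with the first coordinate split off *)

Section slices.
Context n (a b : 'I_n.+1 -> R) (f : 'rV[R]_n.+1 -> R).
Hypothesis ab : forall i, a i <= b i.
Hypothesis cf : forall x, box a b x -> {for x, continuous f}.
Let Q := box (a \o lift ord0) (b \o lift ord0).
Let phi : measurableTypeR R * 'rV[R]_n -> 'rV[R]_n.+1 := @rV_cons R n.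
(** Extending by zero turns the integral over the box into one over the full product space. *)
Let g := (EFin \o f) \_ (box a b) \o phi.

Let mphi : measurable_fun setT phi.
Proof. exact: measurable_rV_cons. Qed.

Let mg : measurable_fun setT ((EFin \o f) \_ (box a b)).
Proof.
apply/(measurable_restrictT _ (measurable_box a b)).
exact: measurable_int (integrable_box ab cf).
Qed.

(** Lebesgue measure on R^(n+1) is the pushforward of the product measure along [phi], so the change
    of variables for nonnegative functions, applied to the absolute value, carries finiteness over
    to [g]. *)
Let ig : (lebesgue_measure \x lebesgue_rV R n)%E.-integrable setT g.
Proof.
have : (lebesgue_rV R n.+1).-integrable setT ((EFin \o f) \_ (box a b)).
  by apply/(integrable_mkcond _ (measurable_box a b)); exact: integrable_box.
move=> /integrableP[_ ioo]; apply/integrableP; split.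
  exact: measurableT_comp mg mphi.
apply: le_lt_trans ioo.
have mabs : measurable_fun setT (fun x => `|((EFin \o f) \_ (box a b)) x|%E).
  exact: measurableT_comp.
have := ge0_integral_pushforward mphi
  (lebesgue_measure \x lebesgue_rV R n)%E measurableT mabs (fun _ _ => abse_ge0 _).
by rewrite preimage_setT => <-.
Qed.

Let ifg : (\int[lebesgue_rV R n.+1]_(x in box a b) (f x)%:E =
  \int[lebesgue_measure \x lebesgue_rV R n]_p g p)%E.
Proof.
rewrite integral_mkcond.
exact: (integral_pushforward mphi mg ig measurableT).
Qed.

(** The inner integral runs over the tail here and over the head in [integral_box_consr]; having
    both orders lets the differentiated coordinate always be an inner one. *)
Lemma integral_box_consl : (\int[lebesgue_rV R n.+1]_(x in box a b) (f x)%:E =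
  \int[lebesgue_measure]_(t in `[a ord0, b ord0]%classic)
    \int[lebesgue_rV R n]_(y in Q) (f (rV_cons (t, y)))%:E)%E.
Proof.
rewrite ifg -integral12_prod_meas1// [RHS]integral_mkcond.
apply: eq_integral => t _; rewrite patchE /fubini_F.
case: ifPn => [/set_mem tab|/negP tab].
  rewrite [RHS]integral_mkcond; apply: eq_integral => y _.
  rewrite /g /= !patchE; congr (if _ then _ else _).
  by apply/asbool_equiv_eq; rewrite box_cons; split => [[]|].
apply: integral0_eq => y _; rewrite /g /= patchE ifF//; apply/negP => /set_mem.
by rewrite box_cons => -[? _]; apply: tab; exact/mem_set.
Qed.

Lemma integral_box_consr : (\int[lebesgue_rV R n.+1]_(x in box a b) (f x)%:E =
  \int[lebesgue_rV R n]_(y in Q)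
    \int[lebesgue_measure]_(t in `[a ord0, b ord0]%classic) (f (rV_cons (t, y)))%:E)%E.
Proof.
rewrite ifg -integral21_prod_meas1// [RHS]integral_mkcond.
apply: eq_integral => y _; rewrite patchE /fubini_G.
case: ifPn => [/set_mem Qy|/negP Qy].
  rewrite [RHS]integral_mkcond; apply: eq_integral => t _.
  rewrite /g /= !patchE; congr (if _ then _ else _).
  by apply/asbool_equiv_eq; rewrite box_cons; split => [[]|].
apply: integral0_eq => t _; rewrite /g /= patchE ifF//; apply/negP => /set_mem.
by rewrite box_cons => -[_ ?]; apply: Qy; exact/mem_set.
Qed.

End slices.

Lemma continuous_slicel n (f : 'rV[R]_n.+1 -> R) t y :
  {for rV_cons (t, y), continuous f} ->
  {for t, continuous (fun s => f (rV_cons (s, y)))}.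
Proof.
move=> cf; apply: (@continuous_comp _ _ _ (fun s => rV_cons (s, y)) f) => //.
apply: (@continuous_comp _ _ _ (fun s : R => (s, y)) (@rV_cons R n)).
  exact: (@cvg_pair _ _ _ (nbhs t) (nbhs t) (nbhs y) _ _ _
    idfun (cst y) cvg_id (cvg_cst y)).
exact: continuous_rV_cons.
Qed.

Lemma continuous_slicer n (f : 'rV[R]_n.+1 -> R) t y :
  {for rV_cons (t, y), continuous f} ->
  {for y, continuous (fun z => f (rV_cons (t, z)))}.
Proof.
move=> cf; apply: (@continuous_comp _ _ _ (fun z => rV_cons (t, z)) f) => //.
apply: (@continuous_comp _ _ _ (fun z : 'rV[R]_n => (t, z)) (@rV_cons R n)).
  exact: (@cvg_pair _ _ _ (nbhs y) (nbhs t) (nbhs y) _ _ _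
    (cst t) idfun (cvg_cst t) cvg_id).
exact: continuous_rV_cons.
Qed.

(** The fundamental theorem of calculus. Derivability on the closed interval gives the continuity of
    [F] at the endpoints. *)
Lemma integral_derivative0 (a b : R) (F : R -> R) : a < b ->
  (forall t, `[a, b]%classic t -> derivable F t 1) ->
  (forall t, `[a, b]%classic t -> {for t, continuous ('D_1 F)}) ->
  F a = 0 -> F b = 0 ->
  (\int[lebesgue_measure]_(t in `[a, b]) ('D_1 F t)%:E = 0)%E.
Proof.
move=> ab dF cF Fa Fb.
have cF' t : `[a, b]%classic t -> {for t, continuous F}.
  by move=> /dF dFt; apply: differentiable_continuous; exact/derivable1_diffP.
rewrite (@continuous_FTC2 _ _ F)//; first by rewrite Fa Fb subee.
- by apply: continuous_in_subspaceT => t /set_mem; exact: cF.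
- split.
  + by move=> t /subset_itv_oo_cc; exact: dF.
  + by apply: cvg_at_right_filter; apply: cF'; rewrite /= in_itv /= lexx ltW.
  + by apply: cvg_at_left_filter; apply: cF'; rewrite /= in_itv /= lexx ltW.
- by move=> t _; rewrite derive1E.
Qed.

(** Only the two faces orthogonal to axis [i] matter. Induction on the dimension peels off
    coordinates until the differentiated one comes first. *)
Lemma integral_partial_box n (i : 'I_n) (a b : 'I_n -> R) (F : 'rV[R]_n -> R) :
  (forall j, a j < b j) ->
  (forall x, box a b x -> derivable F x (delta_mx ord0 i)) ->
  (forall x, box a b x -> {for x, continuous (partial i F)}) ->
  (forall x, box a b x -> x ord0 i = a i \/ x ord0 i = b i -> F x = 0) ->
  (\int[lebesgue_rV R n]_(x in box a b) (partial i F x)%:E = 0)%E.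
Proof.
elim: n i a b F => [[]//|n IHn] i a b F ab dF cF F0.
have ab' j : a j <= b j by exact: ltW.
case: (unliftP ord0 i) => [j|] iE; subst i.
  (* Axis [i] lies in the tail: for fixed [t] the induction hypothesis applies to the slice. *)
  rewrite integral_box_consl//; apply: integral0_eq => t tab.
  have E y := @derive_comp_affine _ _ F (fun z => rV_cons (t, z)) y
    (delta_mx ord0 j) _ (rV_cons_deltar (t, y) j).
  rewrite (eq_integral (fun y => (partial j (fun z => F (rV_cons (t, z))) y)%:E)).
    apply: IHn => [k|y Qy|y Qy|y Qy yj].
    - exact: ab.
    - by rewrite (E y); apply: dF; rewrite box_cons.
    - rewrite (_ : partial _ _ = fun z => partial (lift ord0 j) F (rV_cons (t, z))).
        by apply: continuous_slicer; apply: cF; rewrite box_cons.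
      by apply/funext => z; rewrite /partial (E z).
    - apply: F0; rewrite ?box_cons//.
      by rewrite mxE liftK.
  by move=> y _; rewrite /partial (E y).
(* Axis [i] is the first one: for fixed [y] a one-variable derivative is integrated, with zero
   values at both ends. *)
rewrite integral_box_consr//; apply: integral0_eq => y Qy.
have E t := @derive_comp_affine _ _ F (fun s => rV_cons (s, y)) t
    1 _ (rV_cons_deltal (t, y)).
rewrite -[RHS](@integral_derivative0 (a ord0) (b ord0) (fun s => F (rV_cons (s, y)))).
- by apply: eq_integral => t _; rewrite /partial (E t).
- exact: ab.
- by move=> t tab; rewrite (E t); apply: dF; rewrite box_cons.
- move=> t tab; rewrite (_ : 'D_1 (fun s : R => F (rV_cons (s, y))) =
      fun s => partial ord0 F (rV_cons (s, y))).
    by apply: continuous_slicel; apply: cF; rewrite box_cons.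
  by apply/funext => s; rewrite /partial (E s).
- apply: F0; last by left; rewrite mxE unlift_none.
  by rewrite box_cons; split=> //; rewrite /= in_itv /= lexx ab'.
- apply: F0; last by right; rewrite mxE unlift_none.
  by rewrite box_cons; split=> //; rewrite /= in_itv /= lexx ab'.
Qed.
End divergence_over_boxes.

(** * Integration by parts against powers of the bump, and the resulting adjoint *)

Section integration_by_parts.
Context (R : realType) (n : nat) (Omega : set 'rV[R]_n) (a b : 'I_n -> R).
Hypothesis Omega_open : open Omega.
Hypothesis ab : forall i, a i < b i.
Hypothesis Q_Omega : box a b `<=` Omega.
Implicit Types (f g u w : 'rV[R]_n -> R) (x : 'rV[R]_n).

Local Notation mu := (lebesgue_rV R n).
Local Notation Q := (box a b).

Definition box_bump : 'rV[R]_n -> R :=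
  fun x => \prod_(i < n) ((x ord0 i - a i) * (b i - x ord0 i)).

Local Notation P := box_bump.

Lemma smooth_box_bump : smooth_on Omega P.
Proof.
apply: smooth_on_prod => // i.
apply: (smooth_onM Omega_open (f := fun x => x ord0 i - a i)
  (g := fun x => b i - x ord0 i)).
  apply: (smooth_onD Omega_open (f := fun x => x ord0 i)
    (g := cst (- a i))).
    exact: smooth_on_coord.
  exact: smooth_on_cst.
apply: (smooth_on_ext Omega_open
  (f := cst (b i) + cst (-1) * (fun x => x ord0 i))).
  by move=> x _; rewrite !fctE mulN1r.
apply: smooth_onD => //; first exact: smooth_on_cst.
by apply: smooth_onM => //; [exact: smooth_on_cst|exact: smooth_on_coord].
Qed.

Lemma smooth_box_bumpX k : smooth_on Omega (P ^+ k).
Proof. by apply: smooth_onX => //; exact: smooth_box_bump. Qed.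

Lemma box_bump_ge0 x : Q x -> 0 <= P x.
Proof.
move=> Qx; apply: prodr_ge0 => i _.
have := Qx i; rewrite /= in_itv /= => /andP[ax xb].
by rewrite mulr_ge0// subr_ge0.
Qed.

Lemma box_bump_face i x : x ord0 i = a i \/ x ord0 i = b i -> P x = 0.
Proof.
move=> xi; rewrite /P (bigD1 i)//=.
by case: xi => ->; rewrite subrr ?(mul0r, mulr0).
Qed.

Lemma smooth_integrable f : smooth_on Omega f -> mu.-integrable Q (EFin \o f).
Proof.
move=> sf; apply: integrable_box => [i|x Qx]; first exact: ltW.
exact: smooth_on_continuous sf (Q_Omega Qx).
Qed.

Lemma Rintegral_box_bump_gt0 k : 0 < \int[mu]_(x in Q) (P ^+ k) x.
Proof.
(* [P] is bounded below on the middle third of the box. *)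
pose c i := (a i + a i + b i) / 3; pose d i := (a i + b i + b i) / 3.
have cd i : [/\ a i < c i, c i < d i & d i < b i].
  by have := ab i; rewrite /c /d => ?; split; lra.
(* On the middle third, [x_i - a_i >= c_i - a_i] and [b_i - x_i >= b_i - d_i], so [P ^+ k >= delta]
   there. *)
pose delta := (\prod_(i < n) ((c i - a i) * (b i - d i))) ^+ k.
have delta0 : 0 < delta.
  apply/exprn_gt0/prodr_gt0 => i _.
  by have [? ? ?] := cd i; rewrite mulr_gt0// subr_gt0.
have cdQ : box c d `<=` Q.
  move=> x cdx i; have := cdx i; have [? ? ?] := cd i.
  by rewrite /= !in_itv /=; lra.
have mcd := measurable_box c d; have mQ := measurable_box a b.
have iPk := smooth_integrable (smooth_box_bumpX k).
have Pk0 x : Q x -> 0 <= (P ^+ k) x.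
  by move=> Qx; rewrite fctE exprn_ge0// box_bump_ge0.
apply: (@lt_le_trans _ _ (delta * \prod_(i < n) (d i - c i))).
  rewrite mulr_gt0//; apply: prodr_gt0 => i _.
  by have [] := cd i; rewrite subr_gt0.
rewrite -lee_fin /Rintegral fineK; last exact: integrable_fin_num.
have Pk0' x : Q x -> (0 <= ((P ^+ k) x)%:E)%E by move=> Qx; rewrite lee_fin Pk0.
apply: le_trans (ge0_subset_integral mu mcd mQ (measurable_int _ iPk) Pk0' cdQ).
rewrite EFinM -lebesgue_box; last by move=> i; have [_ /ltW] := cd i.
rewrite -integral_cst//; apply: ge0_le_integral => //.
- by move=> x _; rewrite lee_fin ltW.
- exact: measurable_funS mQ cdQ (measurable_int _ iPk).
- move=> x cdx; rewrite lee_fin fctE lerXn2r ?nnegrE//.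
  + by rewrite prodr_ge0// => i _; have [? ? ?] := cd i; rewrite mulr_ge0// subr_ge0 ltW.
  + exact/box_bump_ge0/cdQ.
  apply: ler_prod => i _; have [? ? ?] := cd i; have := cdx i.
  rewrite /= in_itv /= => /andP[? ?].
  apply/andP; split; first by apply: mulr_ge0; lra.
  by apply: ler_pM; lra.
Qed.

(** The product [P ^+ m.+1 * g * w] vanishes on the faces, since the exponent leaves at least one
    factor [P]. Hence its partial derivative integrates to zero, and the product rule splits that
    integral in two. *)
Lemma Rintegral_by_parts i m g w : smooth_on Omega g -> smooth_on Omega w ->
  \int[mu]_(x in Q) ((P ^+ m.+1) x * g x * partial i w x) =
  - \int[mu]_(x in Q) (partial i (P ^+ m.+1 * g) x * w x).
Proof.
move=> sg sw; set f := P ^+ m.+1 * g.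
have sf : smooth_on Omega f := smooth_onM Omega_open (smooth_box_bumpX m.+1) sg.
have sfw : smooth_on Omega (f * w) := smooth_onM Omega_open sf sw.
have sf' := smooth_on_partials [:: i] sf.
have sw' := smooth_on_partials [:: i] sw.
have H : (\int[mu]_(x in Q) (partial i (f * w) x)%:E = 0)%E.
  apply: integral_partial_box => //.
  - by move=> x /Q_Omega Ox; exact: smooth_on_derivable sfw Ox.
  - by move=> x /Q_Omega Ox; have [] := sfw [:: i] x Ox.
  - move=> x _ /box_bump_face Px0.
    by rewrite /f !fctE /= exprS Px0 !mul0r.
apply/eqP; rewrite -addr_eq0 -RintegralD; last 3 first.
- exact: measurable_box.
- exact: (smooth_integrable (smooth_onM Omega_open sf sw')).
- exact: (smooth_integrable (smooth_onM Omega_open sf' sw)).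
apply/eqP; rewrite -[RHS](congr1 fine H); congr fine.
by apply: eq_integral => x /set_mem/Q_Omega Ox; rewrite (partialM i sf sw Ox).
Qed.

(* Each integration by parts costs one power of the bump, whence the exponent in
   [adjoint_partials]. *)
Lemma partial_box_bumpM i m g x : smooth_on Omega g -> Omega x ->
  partial i (P ^+ m.+1 * g) x =
  (P ^+ m) x * (m.+1%:R * partial i P x * g x + P x * partial i g x).
Proof.
move=> sg Ox; rewrite (partialM i (smooth_box_bumpX m.+1) sg Ox).
rewrite (partialX m.+1 i smooth_box_bump Ox).
have PX k : (P ^+ k) x = P x ^+ k by rewrite fctE.
by rewrite !PX exprS /=; ring.
Qed.

(** Induction on [s]: integrating by parts moves the outermost derivative onto the weight, which
    passes from [P ^+ k.+1 * g] to [P ^+ k * g']. The bound on [size s] ensures that the powers of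
    [P] suffice. The function [h] is found before [u] is given. *)
Lemma adjoint_partials s k g : (size s <= k)%N -> smooth_on Omega g ->
  exists2 h, smooth_on Omega h & forall u, smooth_on Omega u ->
    \int[mu]_(x in Q) ((P ^+ k) x * g x * partials s u x) =
    \int[mu]_(x in Q) (h x * u x).
Proof.
elim: s k g => [|i s IHs] k g sk sg.
  by exists (P ^+ k * g); first exact: (smooth_onM Omega_open (smooth_box_bumpX k) sg).
case: k sk => [//|k] sk.
have sP := smooth_box_bump.
(* Minus the cofactor of [P ^+ k] in [partial_box_bumpM]; the sign is that of the integration by
   parts. *)
pose g' := cst (- 1) * (cst k.+1%:R * partial i P * g + P * partial i g).
have sg' : smooth_on Omega g'.
  have sc r : smooth_on Omega (cst r) by exact: smooth_on_cst.
  have sP' := smooth_on_partials [:: i] sP.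
  have sg'' := smooth_on_partials [:: i] sg.
  apply: (smooth_onM Omega_open (sc _)).
  apply: (smooth_onD Omega_open _ (smooth_onM Omega_open sP sg'')).
  exact: (smooth_onM Omega_open (smooth_onM Omega_open (sc _) sP') sg).
have [h sh hP] := IHs k g' sk sg'; exists h => // u su.
rewrite -hP// (Rintegral_by_parts i k sg (smooth_on_partials s su)).
rewrite -mulN1r -RintegralZl; last 2 first.
- exact: measurable_box.
- apply: (smooth_integrable (f := partial i (P ^+ k.+1 * g) * partials s u)).
  have sPg := smooth_onM Omega_open (smooth_box_bumpX k.+1) sg.
  exact: (smooth_onM Omega_open (smooth_on_partials [:: i] sPg)
    (smooth_on_partials s su)).
apply: eq_Rintegral => x /set_mem /Q_Omega Ox.
by rewrite partial_box_bumpM// /g' !fctE; ring.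
Qed.

(** [mpartial alpha] is by conversion [partials] along this sequence, whose length is the order of
    [alpha]. *)
Definition mindex_seq (alpha : multi_index n) : seq 'I_n :=
  flatten [seq nseq (alpha i) i | i <- enum 'I_n].

Lemma smooth_on_diff_op (L : seq (multi_index n)) (c : multi_index n -> 'rV[R]_n -> R) u :
  {in L, forall alpha, smooth_on Omega (c alpha)} -> smooth_on Omega u ->
  smooth_on Omega (fun x => \sum_(alpha <- L) c alpha x * mpartial alpha u x).
Proof.
move=> + su; elim: L => [|alpha L IHL] sc.
  by under eq_fun do rewrite big_nil; exact: smooth_on_cst.
rewrite (_ : (fun _ => _) = c alpha * mpartial alpha u +
  (fun x => \sum_(beta <- L) c beta x * mpartial beta u x)).
  have sca : smooth_on Omega (c alpha) by apply: sc; rewrite mem_head.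
  apply: (smooth_onD Omega_open
    (smooth_onM Omega_open sca (smooth_on_partials (mindex_seq alpha) su))).
  by apply: IHL => beta Lb; apply: sc; rewrite inE Lb orbT.
by apply/funext => x; rewrite big_cons.
Qed.

(** The adjoints of the terms add up, with [c alpha] in the role of [g]. A common exponent [k], at
    least the order of every term, gives all terms the same weight. *)
Lemma adjoint_diff_op (L : seq (multi_index n)) (c : multi_index n -> 'rV[R]_n -> R) k :
  {in L, forall alpha, smooth_on Omega (c alpha)} ->
  {in L, forall alpha, (size (mindex_seq alpha) <= k)%N} ->
  exists2 h, smooth_on Omega h & forall u, smooth_on Omega u ->
    \int[mu]_(x in Q) ((P ^+ k) x * \sum_(alpha <- L) c alpha x * mpartial alpha u x) =
    \int[mu]_(x in Q) (h x * u x).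
Proof.
elim: L => [|alpha L IHL] sc kL.
  exists (cst 0); first exact: smooth_on_cst.
  by move=> u _; apply: eq_Rintegral => x _; rewrite big_nil mulr0 mul0r.
have sc' : {in L, forall alpha, smooth_on Omega (c alpha)}.
  by move=> beta Lb; apply: sc; rewrite inE Lb orbT.
have [||h2 sh2 h2P] := IHL => //.
  by move=> beta Lb; apply: kL; rewrite inE Lb orbT.
have sca : smooth_on Omega (c alpha) by apply: sc; rewrite mem_head.
have [|h1 sh1 h1P] := @adjoint_partials (mindex_seq alpha) k (c alpha) _ sca.
  by apply: kL; rewrite mem_head.
have sPk := smooth_box_bumpX k.
exists (h1 + h2) => [|u su]; first exact: smooth_onD.
rewrite [RHS](eq_Rintegral mu (g := fun x => h1 x * u x + h2 x * u x)); last first.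
  by move=> x _; rewrite fctE mulrDl.
rewrite RintegralD; last 3 first.
- exact: measurable_box.
- exact: (smooth_integrable (smooth_onM Omega_open sh1 su)).
- exact: (smooth_integrable (smooth_onM Omega_open sh2 su)).
rewrite -h1P// -h2P// -RintegralD; last 3 first.
- exact: measurable_box.
- apply: (smooth_integrable (f := P ^+ k * c alpha * partials (mindex_seq alpha) u)).
  exact: (smooth_onM Omega_open (smooth_onM Omega_open sPk sca)
    (smooth_on_partials (mindex_seq alpha) su)).
- apply: (smooth_integrable (f := P ^+ k *
    (fun x => \sum_(beta <- L) c beta x * mpartial beta u x))).
  exact: (smooth_onM Omega_open sPk (smooth_on_diff_op sc' su)).
by apply: eq_Rintegral => x _; rewrite big_cons mulrDr mulrA.
Qed.

End integration_by_parts.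

(** * Choice of the box and the lower bound *)

Lemma open_box_subset (R : realType) n (Omega : set 'rV[R]_n) :
  open Omega -> Omega !=set0 ->
  exists a b : 'I_n -> R, (forall i, a i < b i) /\ box a b `<=` Omega.
Proof.
move=> oO [x0 Ox0].
have /nbhs_ballP[e /= e0 xeO] : nbhs x0 Omega by exact: open_nbhs_nbhs.
(* The ball is an open cube; halving the radius fits a closed box inside it. *)
exists (fun i => x0 ord0 i - e / 2), (fun i => x0 ord0 i + e / 2); split=> [i|x Qx].
  by rewrite ltrD2l gtrN ?divr_gt0.
apply: xeO; split=> // i j; rewrite (ord1 i).
have := Qx j; rewrite /= in_itv /= /ball /= ltr_distlC => /andP[? ?].
by apply/andP; split; lra.
Qed.

Unset Implicit Arguments.
Set Strict Implicit.

Theorem proposition1p2 (R : realType) (n : nat) (Omega : set 'rV[R]_n)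
    (Omega_neq0 : Omega !=set0) (Omega_open : open Omega)
    (Omega_bounded : bounded_set Omega) (D : diff_operator Omega) :
  exists c : R, 0 < c /\
    forall u : 'rV[R]_n -> R, smooth_on Omega u ->
      (forall x, Omega x -> 1 <= do_apply D u x) ->
      (c%:E <= L1norm Omega u)%E.
Proof.
have [a [b [ab QO]]] := open_box_subset Omega_open Omega_neq0.
(* The largest order in the support of [D], or 0 if the support is empty. *)
pose k := (\max_(alpha <- do_support D) size (mindex_seq alpha))%N.
have [|h sh hP] := adjoint_diff_op Omega_open ab QO (k := k) (@do_smooth _ _ _ D).
  by move=> alpha Da; rewrite /k (big_rem alpha)//= leq_maxl.
have sPk := smooth_box_bumpX a b Omega_open k.
have [|K K0 hK] := @box_bounded R n a b h.
  by move=> x Qx; exact: smooth_on_continuous sh (QO x Qx).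
(* Here [K] bounds [|h|] on the box. The box, [h] and [K] are all fixed before [u]. *)
exists ((\int[lebesgue_rV R n]_(x in box a b) (box_bump a b ^+ k) x) / K).
split=> [|u su Du]; first by rewrite divr_gt0// (Rintegral_box_bump_gt0 Omega_open ab QO).
have cu x : Omega x -> {for x, continuous u} by exact: smooth_on_continuous.
have mQ := measurable_box a b; have mO := open_measurable_rV Omega_open.
have iu : (lebesgue_rV R n).-integrable (box a b) (EFin \o (fun x => `|u x|)).
  by apply: (integrable_norm (smooth_integrable ab QO su)).
have mu : measurable_fun Omega (fun x => `|u x|%:E).
  apply/measurable_EFinP; apply: measurableT_comp => //.
  exact: measurable_fun_rV_continuous.
(* The norm over [Omega] may be infinite; passing to the box lowers it to a finite integral. *)
apply: le_trans (ge0_subset_integral (lebesgue_rV R n) mQ mO mu _ QO).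
  2: by move=> x _; rewrite lee_fin.
rewrite -(fineK (integrable_fin_num mQ iu)) lee_fin ler_pdivrMr// mulrC.
rewrite -[fine _]/(Rintegral _ _ _) -RintegralZl//.
(* First [P ^+ k <= P ^+ k * D u] on the box, from [D u >= 1] and [P >= 0]. *)
apply: (@le_trans _ _ (\int[lebesgue_rV R n]_(x in box a b)
    ((box_bump a b ^+ k) x * do_apply D u x))).
  apply: le_Rintegral => //.
  - exact: smooth_integrable sPk.
  - apply: (smooth_integrable ab QO (f := box_bump a b ^+ k * do_apply D u)).
    exact: (smooth_onM Omega_open sPk (smooth_on_diff_op Omega_open (@do_smooth _ _ _ D) su)).
  - move=> x Qx; rewrite ler_peMr//; last exact/Du/QO.
    by rewrite fctE exprn_ge0// box_bump_ge0.
(* Then the adjoint identity, followed by [h u <= |h| |u| <= K |u|]. *)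
rewrite hP//; apply: le_Rintegral => //.
- exact: (smooth_integrable ab QO (smooth_onM Omega_open sh su)).
- by apply: eq_integrable (integrableZl mQ K iu) => // x _; rewrite /= EFinM.
- move=> x Qx; apply: le_trans (ler_norm _) _.
  by rewrite normrM ler_wpM2r// hK.
Qed.
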